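(* Let $\phi$ be a finite or infinite closed proposition, viewed as a (possibly infinite) $\lambda$-term via the encoding below. Then the Böhm tree of $\phi$ (its normal form in $\lambda_{\beta\bot_{\mathcal{US}}}$) is either $\mathbf{T}$, $\mathbf{F}$ or $\bot$.
   Context: $\Lambda^\infty$ denotes the set of finite and infinite $\lambda$-terms, given by reading the grammar $M::=x\mid\lambda x.M\mid (MM)$ coinductively (terms as possibly infinite trees, modulo $\alpha$); reductions may be infinite but must be strongly convergent (converging in the standard tree metric, with the depth of contracted redexes tending to infinity at limit stages). A closed term $M$ is solvable if $M N_1\ldots N_k$ reduces to $\mathbf{I}\equiv\lambda x.x$ for some $k\ge 0$ and terms $N_1,\dots,N_k$; an open term is solvable iff its closure is; otherwise it is unsolvable. $\mathcal{US}$ is the set of unsolvable terms. The infinitary calculus $\lambda_{\beta\bot_{\mathcal{US}}}$ has terms over the coinductive syntax extended with a constant $\bot$ (restricted to those that arise as limits of strongly convergent reductions from finite $\lambda$-terms), and reduction rules $\beta$ together with the rule $C[M]\to C[\bot]$ whenever $M[\bot:=\Omega]\in\mathcal{US}$, where $\Omega\equiv(\lambda x.xx)(\lambda x.xx)$. This calculus is confluent and normalising for strongly convergent reduction; the Böhm tree of a term is its unique normal form there. Encoding: $\mathbf{T}\equiv\lambda xy.x$, $\mathbf{F}\equiv\lambda xy.y$, $\neg M\equiv M\,\mathbf{F}\,\mathbf{T}$, $M\land N\equiv M\,N\,M$, $M\lor N\equiv M\,M\,N$, $M\rightarrow N\equiv M\,N\,\mathbf{T}$. Finite or infinite propositions are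 given by the grammar $\phi ::= p\mid \mathbf{T}\mid \mathbf{F}\mid (\phi\land\phi)\mid(\phi\lor\phi)\mid(\phi\rightarrow\phi)\mid\neg\phi$ read coinductively ($p$ ranging over propositional variables); a proposition is closed if it contains no propositional variables. *)

(* Defs.v *)
From Stdlib Require Import List Relations.

Set Implicit Arguments.
Unset Strict Implicit.
Unset Printing Implicit Defensive.

(** * Finite and infinite terms *)

(* De Bruijn indices, so alpha-equivalent terms are identified.  Identity of
   possibly infinite trees is [bisim], not [eq]. *)
CoInductive term : Type :=
| Var (x : nat)
| Lam (M : term)
| App (M N : term)
| Bot.

CoInductive bisim : term -> term -> Prop :=
| bisim_Var x : bisim (Var x) (Var x)
| bisim_Lam M M' : bisim M M' -> bisim (Lam M) (Lam M')
| bisim_App M M' N N' :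
    bisim M M' -> bisim N N' -> bisim (App M N) (App M' N')
| bisim_Bot : bisim Bot Bot.

(* [fv x M]: the index [x], read outside [M], occurs free in [M]. *)
Inductive fv : nat -> term -> Prop :=
| fv_Var x : fv x (Var x)
| fv_Lam x M : fv (S x) M -> fv x (Lam M)
| fv_AppL x M N : fv x M -> fv x (App M N)
| fv_AppR x M N : fv x N -> fv x (App M N).

Definition closed (M : term) : Prop := forall x, ~ fv x M.

Inductive bot_occurs : term -> Prop :=
| bot_occurs_Bot : bot_occurs Bot
| bot_occurs_Lam M : bot_occurs M -> bot_occurs (Lam M)
| bot_occurs_AppL M N : bot_occurs M -> bot_occurs (App M N)
| bot_occurs_AppR M N : bot_occurs N -> bot_occurs (App M N).

(* The terms of the calculus without the constant [Bot]. *)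
Definition pure (M : term) : Prop := ~ bot_occurs M.

Definition up_ren (r : nat -> nat) (x : nat) : nat :=
  match x with 0 => 0 | S y => S (r y) end.

CoFixpoint rename (r : nat -> nat) (M : term) : term :=
  match M with
  | Var x => Var (r x)
  | Lam P => Lam (rename (up_ren r) P)
  | App P Q => App (rename r P) (rename r Q)
  | Bot => Bot
  end.

Definition up_subst (s : nat -> term) (x : nat) : term :=
  match x with 0 => Var 0 | S y => rename S (s y) end.

CoFixpoint subst (s : nat -> term) (M : term) : term :=
  match M with
  | Var x => s x
  | Lam P => Lam (subst (up_subst s) P)
  | App P Q => App (subst s P) (subst s Q)
  | Bot => Bot
  end.

(* [inst P Q] is the contractum of [App (Lam P) Q]. *)
Definition inst (P Q : term) : term :=
  subst (fun x => match x with 0 => Q | S y => Var y end) P.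

Definition tI : term := Lam (Var 0).
Definition tT : term := Lam (Lam (Var 1)).
Definition tF : term := Lam (Lam (Var 0)).
Definition Omega : term :=
  App (Lam (App (Var 0) (Var 0))) (Lam (App (Var 0) (Var 0))).

(* M[Bot := Omega]; no capture is possible since [Omega] is closed. *)
CoFixpoint bot_to_Omega (M : term) : term :=
  match M with
  | Var x => Var x
  | Lam P => Lam (bot_to_Omega P)
  | App P Q => App (bot_to_Omega P) (bot_to_Omega Q)
  | Bot => Omega
  end.

Definition lams (n : nat) (M : term) : term := Nat.iter n Lam M.

Definition apps (M : term) (Ns : list term) : term := fold_left App Ns M.

(** * Strongly convergent reduction *)

(* [agree n M N]: the distance of [M] and [N] in the tree metric is at most
   2^-n, that is, the trees coincide at all depths below [n]. *)
Fixpoint agree (n : nat) (M N : term) : Prop :=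
  match n with
  | 0 => True
  | S n =>
      match M, N with
      | Var x, Var y => x = y
      | Lam P, Lam P' => agree n P P'
      | App P Q, App P' Q' => agree n P P' /\ agree n Q Q'
      | Bot, Bot => True
      | _, _ => False
      end
  end.

Section Reduction.

Variable rule : term -> term -> Prop.

Inductive step_at : nat -> term -> term -> Prop :=
| step_root M N : rule M N -> step_at 0 M N
| step_Lam n M M' : step_at n M M' -> step_at (S n) (Lam M) (Lam M')
| step_AppL n M M' N : step_at n M M' -> step_at (S n) (App M N) (App M' N)
| step_AppR n M N N' : step_at n N N' -> step_at (S n) (App M N) (App M N').

(* One step contracting a redex at depth [n], on terms up to [bisim]. *)
Definition step (n : nat) (M N : term) : Prop :=
  exists P Q, bisim M P /\ step_at n P Q /\ bisim Q N.

Definition normal (M : term) : Prop := ~ exists n N, step n M N.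

Definition is_well_order (I : Type) (lt : I -> I -> Prop) : Prop :=
  well_founded lt /\ transitive I lt /\
  forall i j, lt i j \/ i = j \/ lt j i.

Definition is_succ (I : Type) (lt : I -> I -> Prop) (i j : I) : Prop :=
  lt i j /\ ~ exists k, lt i k /\ lt k j.

Definition is_limit (I : Type) (lt : I -> I -> Prop) (l : I) : Prop :=
  (exists i, lt i l) /\ ~ exists i, is_succ lt i l.

(* Strongly convergent reduction of arbitrary ordinal length alpha: the
   well-order [I], with least element [first] and greatest element [last],
   plays the role of the set of ordinals <= alpha.  [s i] is the i-th term of
   the reduction and, for [i] other than [last], [d i] is the depth of the
   redex contracted in passing from [s i] to its successor. *)
Definition red (M N : term) : Prop :=
  exists (I : Type) (lt : I -> I -> Prop) (first last : I)
         (s : I -> term) (d : I -> nat),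
    is_well_order lt /\
    (forall i, i = first \/ lt first i) /\
    (forall i, i = last \/ lt i last) /\
    bisim M (s first) /\
    bisim (s last) N /\
    (forall i j, is_succ lt i j -> step (d i) (s i) (s j)) /\
    (forall l, is_limit lt l ->
       forall n, exists i, lt i l /\
         forall j, lt i j -> lt j l -> n <= d j /\ agree n (s j) (s l)).

End Reduction.

Inductive beta : term -> term -> Prop :=
| beta_intro P Q : beta (App (Lam P) Q) (inst P Q).

(** * Unsolvable terms and Böhm trees *)

Definition closed_solvable (M : term) : Prop :=
  exists Ns, Forall pure Ns /\ red beta (apps M Ns) tI.

(* The closure of [M] is [lams n M] for the least [n] making it closed; for
   closed [M] this is [M] itself.  Indices below [n] that do not occur in [M]
   only contribute vacuous abstractions. *)
Definition is_closure (M M' : term) : Prop :=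
  exists n, M' = lams n M /\ closed M' /\ forall m, m < n -> ~ closed (lams m M).

Definition solvable (M : term) : Prop :=
  exists M', is_closure M M' /\ closed_solvable M'.

(* A term with infinitely many free variables has no closure, so it is
   classified neither as solvable nor as unsolvable.  Such terms never occur
   as subterms of a term that has a closure. *)
Definition unsolvable (M : term) : Prop :=
  pure M /\ (exists M', is_closure M M') /\ ~ solvable M.

(* [M <> Bot] excludes the trivial step from [Bot] to itself, which
   [Omega] being unsolvable would otherwise allow. *)
Inductive bot_rule : term -> term -> Prop :=
| bot_rule_intro M :
    M <> Bot -> unsolvable (bot_to_Omega M) -> bot_rule M Bot.

Definition beta_bot : term -> term -> Prop := union term beta bot_rule.

(* [B] is the unique normal form of [M].  Terms range over the full coinductive
   syntax, so that every infinite proposition is covered.  The terms generated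
   from finite ones are closed under [red beta_bot], so for such [M] restricting
   the syntax to them would not change the meaning. *)
Definition bohm_tree (M B : term) : Prop :=
  red beta_bot M B /\ normal beta_bot B /\
  forall B', red beta_bot M B' -> normal beta_bot B' -> bisim B' B.

(** * Finite and infinite propositions *)

CoInductive formula : Type :=
| PVar (p : nat)
| PTrue
| PFalse
| PAnd (a b : formula)
| POr (a b : formula)
| PImp (a b : formula)
| PNot (a : formula).

Inductive pvar_occurs (p : nat) : formula -> Prop :=
| pvar_occurs_PVar : pvar_occurs p (PVar p)
| pvar_occurs_PAndL a b : pvar_occurs p a -> pvar_occurs p (PAnd a b)
| pvar_occurs_PAndR a b : pvar_occurs p b -> pvar_occurs p (PAnd a b)
| pvar_occurs_POrL a b : pvar_occurs p a -> pvar_occurs p (POr a b)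
| pvar_occurs_POrR a b : pvar_occurs p b -> pvar_occurs p (POr a b)
| pvar_occurs_PImpL a b : pvar_occurs p a -> pvar_occurs p (PImp a b)
| pvar_occurs_PImpR a b : pvar_occurs p b -> pvar_occurs p (PImp a b)
| pvar_occurs_PNot a : pvar_occurs p a -> pvar_occurs p (PNot a).

Definition closed_formula (a : formula) : Prop := forall p, ~ pvar_occurs p a.

CoFixpoint encode (a : formula) : term :=
  match a with
  | PVar p => Var p
  | PTrue => tT
  | PFalse => tF
  | PAnd a b => App (App (encode a) (encode b)) (encode a)
  | POr a b => App (App (encode a) (encode a)) (encode b)
  | PImp a b => App (App (encode a) (encode b)) tT
  | PNot a => App (App (encode a) tF) tT
  end.

(* Main.v *)
(** Evaluate a term on a stack of arguments by head reduction; a successful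
    evaluation has finitely many transitions, and [k] transitions inspect the
    term only to depth [k].  A beta step neither increases the number of
    transitions nor destroys success when read backwards, and replacing a
    subterm no substitution instance of which ever evaluates successfully is
    invisible; unsolvable terms are of this kind.  Because of the uniform bound
    [k], success passes to the limit of a strongly convergent reduction, and
    back from the limit to earlier stages.  So successful evaluations are
    invariant under transfinite reduction, in both directions.

    By induction on the number of transitions, a closed proposition that
    evaluates successfully on some stack head-reduces to [tT] or [tF], because
    the connectives put their first argument in head position and then return
    one of their arguments.  A proposition that never evaluates successfully is
    unsolvable.  Uniqueness of the normal form follows by testing it on the
    stack [Var 0; Var 1]. *)

From Stdlib Require Import List Classical Arith Lia Wf_nat Peano_dec.
Require Import Defs.
Import ListNotations.

Set Implicit Arguments.
Unset Strict Implicit.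
Unset Printing Implicit Defensive.

(** * Equality of infinite trees *)

Lemma agree_refl n M : agree n M M.
Proof. revert M; induction n; intros []; simpl; auto. Qed.

Lemma agree_sym n M N : agree n M N -> agree n N M.
Proof.
  revert M N; induction n; intros [] []; simpl; intuition.
Qed.

Lemma agree_trans n M N K : agree n M N -> agree n N K -> agree n M K.
Proof.
  revert M N K; induction n; intros [] [] []; simpl; intuition (try congruence; eauto).
Qed.

Lemma agree_S n M N : agree (S n) M N -> agree n M N.
Proof.
  revert M N; induction n; intros M N H; [exact I|].
  destruct M, N; simpl in H |- *; auto; try contradiction; intuition.
Qed.

Lemma bisim_agree M N : bisim M N -> forall n, agree n M N.
Proof.
  intros H n; revert M N H; induction n; intros M N H; simpl; auto.
  destruct H; auto.
Qed.

(** With this, identities of infinite trees are proved by induction on the depth, where transitivity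
    may be used freely; a direct corecursive proof would lose guardedness there. *)
Lemma agree_bisim M N : (forall n, agree n M N) -> bisim M N.
Proof.
  revert M N; cofix CIH; intros M N H; pose proof (H 1) as H1.
  destruct M, N; simpl in H1; try contradiction.
  - rewrite H1; constructor.
  - constructor; apply CIH; intros n; exact (H (S n)).
  - constructor; apply CIH; intros n; apply (H (S n)).
  - constructor.
Qed.

Lemma bisim_refl M : bisim M M.
Proof. apply agree_bisim; intros; apply agree_refl. Qed.

Lemma bisim_sym M N : bisim M N -> bisim N M.
Proof. intros H; apply agree_bisim; intros; apply agree_sym, bisim_agree, H. Qed.

Lemma bisim_trans M N K : bisim M N -> bisim N K -> bisim M K.
Proof.
  intros H1 H2; apply agree_bisim; intros n.
  apply agree_trans with N; apply bisim_agree; assumption.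
Qed.

(** * Unfolding corecursive functions *)

(** The match forces one unfolding of a corecursive term. *)
Lemma term_eta (M : term) :
  M = match M with Var x => Var x | Lam P => Lam P | App P Q => App P Q | Bot => Bot end.
Proof. destruct M; reflexivity. Qed.

Lemma rename_Var r x : rename r (Var x) = Var (r x).
Proof. rewrite (term_eta (rename _ _)); reflexivity. Qed.
Lemma rename_Lam r P : rename r (Lam P) = Lam (rename (up_ren r) P).
Proof. rewrite (term_eta (rename _ _)); reflexivity. Qed.
Lemma rename_App r P Q : rename r (App P Q) = App (rename r P) (rename r Q).
Proof. rewrite (term_eta (rename _ _)); reflexivity. Qed.
Lemma rename_Bot r : rename r Bot = Bot.
Proof. rewrite (term_eta (rename _ _)); reflexivity. Qed.

Lemma subst_Var s x : subst s (Var x) = s x.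
Proof. rewrite (term_eta (subst _ _)); simpl; symmetry; apply term_eta. Qed.
Lemma subst_Lam s P : subst s (Lam P) = Lam (subst (up_subst s) P).
Proof. rewrite (term_eta (subst _ _)); reflexivity. Qed.
Lemma subst_App s P Q : subst s (App P Q) = App (subst s P) (subst s Q).
Proof. rewrite (term_eta (subst _ _)); reflexivity. Qed.
Lemma subst_Bot s : subst s Bot = Bot.
Proof. rewrite (term_eta (subst _ _)); reflexivity. Qed.

Lemma bot_to_Omega_Var x : bot_to_Omega (Var x) = Var x.
Proof. rewrite (term_eta (bot_to_Omega _)); reflexivity. Qed.
Lemma bot_to_Omega_Lam P : bot_to_Omega (Lam P) = Lam (bot_to_Omega P).
Proof. rewrite (term_eta (bot_to_Omega _)); reflexivity. Qed.
Lemma bot_to_Omega_App P Q :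
  bot_to_Omega (App P Q) = App (bot_to_Omega P) (bot_to_Omega Q).
Proof. rewrite (term_eta (bot_to_Omega _)); reflexivity. Qed.
Lemma bot_to_Omega_Bot : bot_to_Omega Bot = Omega.
Proof. rewrite (term_eta (bot_to_Omega _)); reflexivity. Qed.

#[local] Hint Rewrite rename_Var rename_Lam rename_App rename_Bot
  subst_Var subst_Lam subst_App subst_Bot
  bot_to_Omega_Var bot_to_Omega_Lam bot_to_Omega_App bot_to_Omega_Bot : unfold_term.

Ltac unfold_term := autorewrite with unfold_term in *.

(** * Substitution *)

Lemma rename_agree n r r' M M' :
  (forall x, r x = r' x) -> agree n M M' -> agree n (rename r M) (rename r' M').
Proof.
  revert r r' M M'; induction n; intros r r' M M' Hr H; [exact I|].
  destruct M, M'; simpl in H |- *; try contradiction; auto.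
  - subst; auto.
  - apply IHn; auto. intros [|x]; simpl; auto.
  - intuition.
Qed.

(** Agreement is asked on free variables only, so that the lemma also shows substitution to be the
    identity on closed terms. *)
Lemma subst_agree_fv n s s' M M' :
  (forall x, fv x M -> agree n (s x) (s' x)) -> agree n M M' ->
  agree n (subst s M) (subst s' M').
Proof.
  revert s s' M M'; induction n; intros s s' M M' Hs H; [exact I|].
  destruct M, M'; simpl in H; try contradiction; unfold_term.
  - subst. apply Hs; constructor.
  - simpl. apply IHn; auto. intros [|y] Hy; simpl; [apply agree_refl|].
    apply rename_agree; auto. apply agree_S, Hs; constructor; assumption.
  - simpl; split; (apply IHn; [intros y Hy; apply agree_S, Hs|]); try tauto.
    + apply fv_AppL; assumption.
    + apply fv_AppR; assumption.
  - exact I.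
Qed.

Lemma subst_bisim s s' M M' :
  (forall x, bisim (s x) (s' x)) -> bisim M M' -> bisim (subst s M) (subst s' M').
Proof.
  intros Hs HM; apply agree_bisim; intros n.
  apply subst_agree_fv; intros; apply bisim_agree; auto.
Qed.

Lemma inst_agree n P P' Q Q' :
  agree n P P' -> agree n Q Q' -> agree n (inst P Q) (inst P' Q').
Proof.
  intros; apply subst_agree_fv; auto. intros [|x] _; auto using agree_refl.
Qed.

Lemma inst_bisim P P' Q Q' : bisim P P' -> bisim Q Q' -> bisim (inst P Q) (inst P' Q').
Proof.
  intros; apply agree_bisim; intros; apply inst_agree; apply bisim_agree; assumption.
Qed.

Lemma rename_subst_Var r M : bisim (rename r M) (subst (fun x => Var (r x)) M).
Proof.
  apply agree_bisim; intros n; revert r M; induction n; intros r M; [exact I|].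
  destruct M; unfold_term; simpl; auto.
  eapply agree_trans; [apply IHn|].
  apply subst_agree_fv; [|apply agree_refl].
  intros [|x] _; simpl; unfold_term; apply agree_refl.
Qed.

Lemma rename_rename r r' M : bisim (rename r (rename r' M)) (rename (fun x => r (r' x)) M).
Proof.
  apply agree_bisim; intros n; revert r r' M; induction n; intros r r' M; [exact I|].
  destruct M; unfold_term; simpl; auto.
  eapply agree_trans; [apply IHn|].
  apply rename_agree; [intros []|apply agree_refl]; reflexivity.
Qed.

Lemma subst_rename s r M : bisim (subst s (rename r M)) (subst (fun x => s (r x)) M).
Proof.
  apply agree_bisim; intros n; revert s r M; induction n; intros s r M; [exact I|].
  destruct M; unfold_term; [apply agree_refl|simpl..]; auto.
  eapply agree_trans; [apply IHn|].
  apply subst_agree_fv; [intros [|x] _|]; apply agree_refl.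
Qed.

Lemma rename_subst r s M :
  bisim (rename r (subst s M)) (subst (fun x => rename r (s x)) M).
Proof.
  apply agree_bisim; intros n; revert r s M; induction n; intros r s M; [exact I|].
  destruct M; unfold_term; [apply agree_refl|simpl..]; auto.
  eapply agree_trans; [apply IHn|].
  apply subst_agree_fv; [|apply agree_refl].
  intros [|x] _; simpl; unfold_term; [apply agree_refl|].
  eapply agree_trans; [apply bisim_agree, rename_rename|].
  apply agree_sym, (bisim_agree (rename_rename S r (s x))).
Qed.

Lemma subst_subst t s M :
  bisim (subst t (subst s M)) (subst (fun x => subst t (s x)) M).
Proof.
  apply agree_bisim; intros n; revert t s M; induction n; intros t s M; [exact I|].
  destruct M; unfold_term; [apply agree_refl|simpl..]; auto.
  eapply agree_trans; [apply IHn|].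
  apply subst_agree_fv; [|apply agree_refl].
  intros [|x] _; simpl; unfold_term; [apply agree_refl|].
  eapply agree_trans; [apply bisim_agree, subst_rename|].
  apply agree_sym, bisim_agree, rename_subst.
Qed.

Lemma subst_Var_id M : bisim (subst Var M) M.
Proof.
  apply agree_bisim; intros n; revert M; induction n; intros M; [exact I|].
  destruct M; unfold_term; simpl; auto.
  eapply agree_trans; [|apply IHn].
  apply subst_agree_fv; [|apply agree_refl].
  intros [|x] _; simpl; unfold_term; apply agree_refl.
Qed.

Lemma subst_closed s M : closed M -> bisim (subst s M) M.
Proof.
  intros H; eapply bisim_trans; [|apply subst_Var_id].
  apply agree_bisim; intros n; apply subst_agree_fv; [|apply agree_refl].
  intros x Hx; destruct (H x Hx).
Qed.

Definition scons (Q : term) (s : nat -> term) (x : nat) : term :=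
  match x with 0 => Q | S y => s y end.

Lemma inst_subst_up s P Q : bisim (inst (subst (up_subst s) P) Q) (subst (scons Q s) P).
Proof.
  eapply bisim_trans; [apply subst_subst|].
  apply subst_bisim; [|apply bisim_refl].
  intros [|x]; simpl; unfold_term; [apply bisim_refl|].
  eapply bisim_trans; [apply subst_rename|]. apply subst_Var_id.
Qed.

Lemma subst_inst s P Q :
  bisim (subst s (inst P Q)) (inst (subst (up_subst s) P) (subst s Q)).
Proof.
  eapply bisim_trans; [apply subst_subst|].
  eapply bisim_trans; [|apply bisim_sym, inst_subst_up].
  apply subst_bisim; [|apply bisim_refl].
  intros [|x]; simpl; unfold_term; apply bisim_refl.
Qed.

Lemma inst_rename_S P Q : bisim (inst (rename S P) Q) P.
Proof. eapply bisim_trans; [apply subst_rename|apply subst_Var_id]. Qed.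

(** * Evaluation on a stack *)

(* The pair of a term and a stack of arguments reduces, by head reduction, to
   the variable [x] with an empty stack.  The index bounds the number of
   transitions, hence also the depth to which the arguments are inspected. *)
Inductive ev (x : nat) : nat -> term -> list term -> Prop :=
| ev_Var k : ev x (S k) (Var x) []
| ev_App k P Q Ns : ev x k P (Q :: Ns) -> ev x (S k) (App P Q) Ns
| ev_Lam k P Q Ns : ev x k (inst P Q) Ns -> ev x (S k) (Lam P) (Q :: Ns).

Lemma Forall2_impl A B (R R' : A -> B -> Prop) l l' :
  (forall a b, R a b -> R' a b) -> Forall2 R l l' -> Forall2 R' l l'.
Proof. intros H; induction 1; auto. Qed.

(** A transition descends at most one level and substitution costs no depth, so [k] transitions
    cannot distinguish trees that agree up to depth [k]. With bound 0 nothing evaluates. *)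
Lemma ev_agree x k M M' Ns Ns' :
  ev x k M Ns -> agree k M M' -> Forall2 (agree k) Ns Ns' -> ev x k M' Ns'.
Proof.
  intros H; revert M' Ns'; induction H; intros M' Ns' HM HN;
    destruct M'; simpl in HM; try contradiction.
  - inversion HN; subst; constructor.
  - constructor; apply IHev; try tauto. constructor; try tauto.
    revert HN; apply Forall2_impl; auto using agree_S.
  - inversion HN; subst; constructor; apply IHev.
    + apply inst_agree; auto using agree_S.
    + eapply Forall2_impl; [|eassumption]; auto using agree_S.
Qed.

Lemma Forall2_diag A (R : A -> A -> Prop) l : (forall a, R a a) -> Forall2 R l l.
Proof. intros H; induction l; auto. Qed.

Lemma ev_bisim x k M M' Ns : ev x k M Ns -> bisim M M' -> ev x k M' Ns.
Proof.
  intros H HM; eapply ev_agree; [eassumption|apply bisim_agree, HM|].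
  apply Forall2_diag, agree_refl.
Qed.

Lemma ev_le x k k' M Ns : ev x k M Ns -> k <= k' -> ev x k' M Ns.
Proof.
  intros H; revert k'; induction H; intros [|k'] Hk; try lia;
    constructor; apply IHev; lia.
Qed.

Lemma ev_apps x k M Ns Ns' :
  ev x k (apps M Ns) Ns' -> ev x k M (Ns ++ Ns').
Proof.
  revert M; induction Ns as [|N Ns IH]; intros M H; [exact H|].
  apply IH in H; inversion H; subst. apply ev_le with k0; auto.
Qed.

(** Two transitions lead from [Omega] back to [Omega] on the same stack. *)
Lemma not_ev_Omega x k Ns : ~ ev x k Omega Ns.
Proof.
  revert Ns; induction k as [k IH] using lt_wf_ind; intros Ns H.
  inversion H as [|k1 ? ? ? H1|]; subst; inversion H1 as [| |k2 ? ? ? H2]; subst.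
  unfold inst in H2; unfold_term. apply (IH k2) in H2; auto.
Qed.

(** Quantifying over all instances makes the notion stable under substitution, so that replacing
    such a subterm by [Bot] commutes with surrounding beta steps. *)
Definition inert (M : term) : Prop := forall s x k Ns, ~ ev x k (subst s M) Ns.

Lemma inert_bisim M M' : inert M -> bisim M M' -> inert M'.
Proof.
  intros H HM s x k Ns Hev; apply (H s x k Ns).
  eapply ev_bisim; [eassumption|].
  apply subst_bisim; auto using bisim_refl, bisim_sym.
Qed.

Lemma inert_subst s M : inert M -> inert (subst s M).
Proof.
  intros H s' x k Ns Hev; apply (H (fun y => subst s' (s y)) x k Ns).
  eapply ev_bisim; [eassumption|apply subst_subst].
Qed.

Lemma inert_rename r M : inert M -> inert (rename r M).
Proof.
  intros H. eapply inert_bisim; [apply inert_subst, H|].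
  apply bisim_sym, rename_subst_Var.
Qed.

Lemma inert_Bot : inert Bot.
Proof. intros s x k Ns H; unfold_term; inversion H. Qed.

Lemma inert_Omega : inert Omega.
Proof.
  intros s x k Ns H; apply (@not_ev_Omega x k Ns).
  unfold Omega in *; unfold_term; exact H.
Qed.

(** * Parallel reduction up to a finite depth *)

(* Inductive, although terms are infinite: beyond depth [n] nothing is
   required.  Only finitely many head redexes may be contracted before
   descending, without which [par] would not reflect evaluation backwards
   (coinductively, I (I (I ...)) would reduce to every term). *)
Inductive par : nat -> term -> term -> Prop :=
| par_0 M N : par 0 M N
| par_Var n x : par n (Var x) (Var x)
| par_Lam n P P' : par n P P' -> par (S n) (Lam P) (Lam P')
| par_App n P P' Q Q' : par n P P' -> par n Q Q' -> par (S n) (App P Q) (App P' Q')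
| par_beta n P Q N : par n (inst P Q) N -> par n (App (Lam P) Q) N
| par_inert n M : inert M -> par n M Bot.

Lemma par_bisim n M M' N N' :
  par n M N -> bisim M M' -> bisim N N' -> par n M' N'.
Proof.
  intros H; revert M' N'; induction H; intros M' N' HM HN.
  - constructor.
  - inversion HM; inversion HN; subst; constructor.
  - inversion HM; inversion HN; subst; constructor; auto.
  - inversion HM; inversion HN; subst; constructor; auto.
  - inversion HM as [| |? ? ? ? HL HQ|]; subst; inversion HL; subst.
    constructor; apply IHpar; auto using inst_bisim.
  - inversion HN; subst; constructor. eapply inert_bisim; eassumption.
Qed.

Lemma par_le n m M N : par n M N -> m <= n -> par m M N.
Proof.
  intros H; revert m; induction H; intros [|m] Hm; try lia; constructor; auto;
    try (apply IHpar; lia); try (apply IHpar1; lia); try (apply IHpar2; lia).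
Qed.

Lemma par_refl n M : par n M M.
Proof.
  revert M; induction n; intros []; try constructor; auto using inert_Bot.
Qed.

Lemma par_rename n r M N : par n M N -> par n (rename r M) (rename r N).
Proof.
  intros H; revert r; induction H; intros r; unfold_term; constructor; auto.
  - eapply par_bisim; [apply IHpar| |apply bisim_refl].
    eapply bisim_trans; [apply rename_subst_Var|].
    eapply bisim_trans; [apply subst_inst|].
    apply inst_bisim.
    + eapply bisim_trans; [|apply bisim_sym, rename_subst_Var].
      apply subst_bisim; [intros []|]; simpl; unfold_term; apply bisim_refl.
    + apply bisim_sym, rename_subst_Var.
  - apply inert_rename; assumption.
Qed.

Lemma par_subst n s s' M N :
  par n M N -> (forall x, par n (s x) (s' x)) -> par n (subst s M) (subst s' N).
Proof.
  intros H; revert s s'; induction H; intros s s' Hs; unfold_term; auto; try constructor.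
  - apply IHpar. intros [|x]; simpl; [constructor|].
    apply par_rename, par_le with (S n); auto.
  - apply IHpar1; intros x; apply par_le with (S n); auto.
  - apply IHpar2; intros x; apply par_le with (S n); auto.
  - eapply par_bisim; [apply IHpar, Hs|apply subst_inst|apply bisim_refl].
  - apply inert_subst; assumption.
Qed.

Lemma par_inst n P P' Q Q' : par n P P' -> par n Q Q' -> par n (inst P Q) (inst P' Q').
Proof.
  intros HP HQ; apply par_subst; [assumption|].
  intros [|x]; [assumption|constructor].
Qed.

Lemma ev_inert x k M Ns : ev x k M Ns -> ~ inert M.
Proof.
  intros H Hb; apply (Hb Var x k Ns).
  eapply ev_bisim; [eassumption|apply bisim_sym, subst_Var_id].
Qed.

(** The bound does not grow: a head redex contracted by [par] uses up two transitions of [M] while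
    [N] makes none. Keeping [k] fixed is what allows passage to limits. *)
Lemma ev_par x k M N Ns Ns' :
  ev x k M Ns -> par k M N -> Forall2 (par k) Ns Ns' -> ev x k N Ns'.
Proof.
  revert M N Ns Ns'; induction k as [k IH] using lt_wf_ind; intros M N Ns Ns' H HM HN.
  destruct HM.
  - inversion H.
  - inversion H; subst; inversion HN; subst; constructor.
  - inversion H as [| |? ? ? ? H1]; subst; inversion HN; subst; constructor.
    eapply IH; [auto|eassumption|apply par_inst; eauto using par_le|].
    eapply Forall2_impl; [|eassumption]; eauto using par_le.
  - inversion H as [|? ? ? ? H1|]; subst; constructor.
    eapply IH; [auto|eassumption|assumption|constructor; [assumption|]].
    eapply Forall2_impl; [|eassumption]; eauto using par_le.
  - inversion H as [|? ? ? ? H1|]; subst; inversion H1 as [| |k2 ? ? ? H2]; subst.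
    apply ev_le with k2; [|lia].
    eapply IH; [lia|eassumption|eapply par_le; [eassumption|lia]|].
    eapply Forall2_impl; [|eassumption]. intros a b Hab; eapply par_le; [eassumption|lia].
  - destruct (ev_inert H); assumption.
Qed.

(** Backwards the bound may grow, by two transitions for each head redex contracted on the way to
    [N]. *)
Lemma ev_par_inv x k M N Ns Ns' :
  ev x k N Ns' -> par k M N -> Forall2 (par k) Ns Ns' -> exists k', ev x k' M Ns.
Proof.
  revert M N Ns Ns'; induction k as [k IH] using lt_wf_ind; intros M N Ns Ns' H HM HN.
  (* The inner induction handles [par_beta], which leaves [N] and hence [k] unchanged. *)
  induction HM.
  - inversion H.
  - inversion H; subst; inversion HN; subst; exists 1; constructor.
  - inversion H as [| |? ? ? ? H1]; subst; inversion HN as [|a ? l]; subst.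
    destruct (IH n) with (M := inst P a) (Ns := l) (1 := Nat.lt_succ_diag_r n) (2 := H1)
      as [k' Hk'].
    + apply par_inst; eauto using par_le.
    + eapply Forall2_impl; [|eassumption]; eauto using par_le.
    + exists (S k'); constructor; assumption.
  - inversion H as [|? ? ? ? H1|]; subst.
    destruct (IH n) with (M := P) (Ns := Q :: Ns) (1 := Nat.lt_succ_diag_r n) (2 := H1)
      as [k' Hk']; [assumption| |].
    + constructor; [assumption|].
      eapply Forall2_impl; [|eassumption]; eauto using par_le.
    + exists (S k'); constructor; assumption.
  - destruct IHHM as [k' Hk']; auto.
    exists (S (S k')); constructor; constructor; assumption.
  - inversion H.
Qed.

Lemma par_bot_to_Omega n M : par n (bot_to_Omega M) M.
Proof.
  revert M; induction n; intros []; unfold_term;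
    try (apply par_inert, inert_Omega); constructor; auto.
Qed.

(** * Transfinite reductions *)

(** Transfinite induction along the well-order: a property kept by single steps and closed under
    metric limits is kept by reductions of any length. *)
Lemma red_invariant (rule : term -> term -> Prop) (P : term -> Prop) :
  (forall d M N, step rule d M N -> P M -> P N) ->
  (forall M, (forall n, exists N, agree n N M /\ P N) -> P M) ->
  forall M N, red rule M N -> P M -> P N.
Proof.
  intros Hstep Hlim M N
    (I & lt & fst & lst & s & d & (Hwf & _ & Htot) & Hfst & Hlst & HM & HN & Hs & Hl) HPM.
  (* Closure under [bisim] is closure under limits of constant sequences. *)
  assert (Hb : forall A B, bisim A B -> P A -> P B).
  { intros A B HAB HA; apply Hlim; intros n; exists A; split; auto.
    apply bisim_agree; assumption. }
  apply (Hb _ _ HN). generalize lst; clear N lst Hlst HN.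
  intros i; induction i as [i IH] using (well_founded_ind Hwf).
  destruct (Hfst i) as [->|Hi]; [apply (Hb _ _ HM HPM)|].
  destruct (classic (exists j, is_succ lt j i)) as [[j Hj]|Hn].
  - apply (Hstep _ _ _ (Hs _ _ Hj)), IH, Hj.
  - apply Hlim; intros n.
    destruct (Hl i (conj (ex_intro _ _ Hi) Hn) n) as (j & Hji & Hj).
    (* If nothing lay strictly between [j] and [i], then [i] would be a successor. *)
    destruct (classic (exists k, lt j k /\ lt k i)) as [[k [Hjk Hki]]|Hnk].
    + exists (s k); split; [apply Hj; assumption|apply IH; assumption].
    + destruct Hn; exists j; split; assumption.
Qed.

Lemma step_mono (r r' : term -> term -> Prop) d M N :
  (forall A B, r A B -> r' A B) -> step r d M N -> step r' d M N.
Proof.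
  intros Hr (A & B & HA & H & HB); exists A, B; repeat split; auto.
  clear HA HB; induction H; constructor; auto.
Qed.

Lemma red_mono (r r' : term -> term -> Prop) M N :
  (forall A B, r A B -> r' A B) -> red r M N -> red r' M N.
Proof.
  intros Hr (I & lt & fst & lst & s & d & H1 & H2 & H3 & H4 & H5 & H6 & H7).
  exists I, lt, fst, lst, s, d; repeat (split; [assumption|]); split; [|assumption].
  intros i j Hij; eapply step_mono; [exact Hr|auto].
Qed.

(** * Finite reductions as a special case of transfinite ones *)

Inductive steps (rule : term -> term -> Prop) : term -> term -> Prop :=
| steps_bisim M N : bisim M N -> steps rule M N
| steps_cons d M N K : step rule d M N -> steps rule N K -> steps rule M K.

Lemma steps_trans rule M N K : steps rule M N -> steps rule N K -> steps rule M K.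
Proof.
  intros H; revert K; induction H as [M N H|d M N L H H' IH]; intros K HK.
  - destruct HK as [A B H'|d A B C (X & Y & HX & HXY & HY) H'].
    + apply steps_bisim; eapply bisim_trans; eassumption.
    + eapply steps_cons; [|eassumption].
      exists X, Y; repeat split; [|eassumption|assumption].
      eapply bisim_trans; eassumption.
  - eapply steps_cons; [eassumption|apply IH, HK].
Qed.

Lemma steps_seq rule M N : steps rule M N ->
  exists (k : nat) (s : nat -> term) (d : nat -> nat),
    bisim M (s 0) /\ bisim (s k) N /\ forall i, i < k -> step rule (d i) (s i) (s (S i)).
Proof.
  induction 1 as [M N H|e M N K H _ (k & s & d & HN & HK & Hs)].
  - exists 0, (fun _ => M), (fun _ => 0); repeat split; [apply bisim_refl|assumption|lia].
  - exists (S k), (fun i => match i with 0 => M | S i => s i end),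
      (fun i => match i with 0 => e | S i => d i end).
    repeat split; [apply bisim_refl|assumption|].
    intros [|i] Hi; [|apply Hs; lia].
    destruct H as (A & B & HA & HAB & HB); exists A, B; repeat split; auto.
    eapply bisim_trans; eassumption.
Qed.

Lemma steps_red rule M N : steps rule M N -> red rule M N.
Proof.
  intros H; destruct (steps_seq H) as (k & s & d & HM & HN & Hs).
  (* The ordinals up to [k]; uniqueness of proofs of [<=] makes indices with equal values equal. *)
  pose (I := {i : nat | i <= k}).
  assert (Heq : forall i j : I, proj1_sig i = proj1_sig j -> i = j).
  { intros [i Hi] [j Hj]; simpl; intros ->; f_equal; apply le_unique. }
  exists I, (fun i j => proj1_sig i < proj1_sig j), (exist (fun i => i <= k) 0 (Nat.le_0_l k)),
    (exist (fun i => i <= k) k (le_n k)),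
    (fun i => s (proj1_sig i)), (fun i => d (proj1_sig i)).
  split; [split; [|split]|repeat apply conj]; simpl; auto.
  - apply (well_founded_ltof I (@proj1_sig _ _)).
  - intros i j l; simpl; lia.
  - intros i j; destruct (Nat.lt_trichotomy (proj1_sig i) (proj1_sig j)) as [|[|]]; auto.
  - intros [[|i] Hi]; [left; apply Heq; reflexivity|right; simpl; lia].
  - intros [i Hi]; destruct (Nat.eq_dec i k); [left; apply Heq; assumption|right; simpl; lia].
  - intros [i Hi] [j Hj] [Hij Hn]; simpl in *.
    destruct (Nat.eq_dec j (S i)) as [->|Hne]; [apply Hs; lia|].
    destruct Hn. assert (Hi' : S i <= k) by lia.
    exists (exist (fun i => i <= k) _ Hi'); simpl; lia.
  (* The predecessor of [i] shows that a finite order has no limit elements. *)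
  - intros [i Hi] [[[j Hj] Hji] Hn] n; simpl in *; destruct Hn.
    assert (Hi' : pred i <= k) by lia.
    exists (exist (fun i => i <= k) _ Hi'); split; simpl; [lia|].
    intros [[l Hl] Hl']; simpl in *; lia.
Qed.

(** * Evaluation and reduction *)

Lemma step_apps rule d M N Ns :
  step rule d M N -> exists d', step rule d' (apps M Ns) (apps N Ns).
Proof.
  revert d M N; induction Ns as [|K Ns IH]; intros d M N H; [exists d; exact H|].
  apply (IH (S d)).
  destruct H as (A & B & HA & HAB & HB).
  exists (App A K), (App B K); repeat split; constructor; auto using bisim_refl.
Qed.

Lemma steps_apps rule M N Ns : steps rule M N -> steps rule (apps M Ns) (apps N Ns).
Proof.
  induction 1 as [M N H|d M N K H _ IH].
  - apply steps_bisim; revert M N H; induction Ns; intros M N H; [exact H|].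
    apply IHNs; constructor; auto using bisim_refl.
  - destruct (step_apps Ns H) as [d' Hd']; eapply steps_cons; eassumption.
Qed.

Lemma steps_beta P Q : steps beta (App (Lam P) Q) (inst P Q).
Proof.
  apply steps_cons with 0 (inst P Q); [|apply steps_bisim, bisim_refl].
  exists (App (Lam P) Q), (inst P Q); repeat split; auto using bisim_refl.
  constructor; constructor.
Qed.

(** An evaluation is a head reduction and survives any substitution; choosing [t] constantly [tI]
    later turns the variable reached into [tI]. *)
Lemma ev_steps x k M Ns t :
  ev x k M Ns -> steps beta (apps (subst t M) (map (subst t) Ns)) (t x).
Proof.
  induction 1; unfold_term.
  - apply steps_bisim, bisim_refl.
  - unfold_term; exact IHev.
  - simpl.
    eapply steps_trans; [eapply (steps_apps (map (subst t) Ns)), steps_beta|].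
    eapply steps_trans; [|exact IHev].
    apply steps_apps, steps_bisim, bisim_sym, subst_inst.
Qed.

(** * Free variables, closedness and purity *)

Lemma fv_rename x r M : fv x (rename r M) -> exists y, fv y M /\ x = r y.
Proof.
  intros H; remember (rename r M) as N eqn:E; revert r M E.
  induction H; intros r [] E; unfold_term; inversion E; subst.
  - eexists; split; [constructor|reflexivity].
  - destruct (IHfv _ _ eq_refl) as ([|y] & Hy & Hx); inversion Hx; subst.
    exists y; split; [constructor; assumption|reflexivity].
  - destruct (IHfv _ _ eq_refl) as (y & Hy & ->); exists y; auto using fv_AppL.
  - destruct (IHfv _ _ eq_refl) as (y & Hy & ->); exists y; auto using fv_AppR.
Qed.

Lemma fv_subst x s M : fv x (subst s M) -> exists y, fv y M /\ fv x (s y).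
Proof.
  intros H; remember (subst s M) as N eqn:E; revert s M E.
  induction H; intros s [] E; unfold_term; try discriminate;
    try (eexists; split; [constructor|rewrite <- E; eauto using fv; fail]);
    inversion E; subst.
  - destruct (IHfv _ _ eq_refl) as ([|y] & Hy & Hx); simpl in Hx; [inversion Hx|].
    destruct (fv_rename Hx) as (z & Hz & Hxz); inversion Hxz; subst.
    exists y; auto using fv.
  - destruct (IHfv _ _ eq_refl) as (y & Hy & Hx); exists y; auto using fv.
  - destruct (IHfv _ _ eq_refl) as (y & Hy & Hx); exists y; auto using fv.
Qed.

(** An occurrence lies at a finite depth; hence closedness passes to limits. *)
Lemma fv_agree x M : fv x M -> exists n, forall N, agree n M N -> fv x N.
Proof.
  induction 1 as [x|x M _ [n IH]|x M N _ [n IH]|x M N _ [n IH]];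
    [exists 1|exists (S n)..]; intros []; simpl; try contradiction.
  - intros ->; constructor.
  - intros HP; constructor; auto.
  - intros [HP HQ]; apply fv_AppL; auto.
  - intros [HP HQ]; apply fv_AppR; auto.
Qed.

Lemma fv_step_beta_bot d M N x : step beta_bot d M N -> fv x N -> fv x M.
Proof.
  intros (A & B & HA & H & HB) HN.
  assert (forall M N, bisim M N -> fv x N -> fv x M) as Hb.
  { intros P Q HPQ HQ; destruct (fv_agree HQ) as [n Hn].
    apply Hn, agree_sym, bisim_agree, HPQ. }
  apply (Hb _ _ HA); apply (Hb _ _ HB) in HN; clear - H HN.
  revert x HN; induction H as [A B [H|H]| | |]; intros x HN.
  - destruct H as [P Q]; apply fv_subst in HN as ([|y] & Hy & Hx); [auto using fv|].
    inversion Hx; subst; auto using fv.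
  - destruct H; inversion HN.
  - inversion HN; subst; auto using fv.
  - inversion HN; subst; auto using fv.
  - inversion HN; subst; auto using fv.
Qed.

Lemma closed_red_beta_bot M N : red beta_bot M N -> closed M -> closed N.
Proof.
  apply red_invariant; clear.
  - intros d M N H HM x Hx; apply (HM x), (fv_step_beta_bot H Hx).
  - intros M H x Hx; destruct (fv_agree Hx) as [n Hn]; destruct (H n) as (N & HN & HcN).
    apply (HcN x), Hn, agree_sym, HN.
Qed.

Lemma closed_bot_to_Omega M : closed M -> closed (bot_to_Omega M).
Proof.
  intros H x Hx; apply (H x); clear H.
  remember (bot_to_Omega M) as N eqn:E; revert M E.
  assert (HO : closed Omega).
  { intros y Hy; unfold Omega in Hy;
      repeat match goal with H : fv _ _ |- _ => inversion H; clear H; subst end. }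
  induction Hx; intros [] E; unfold_term; try discriminate;
    try (edestruct HO; rewrite <- E; eauto using fv; fail); inversion E; subst; auto using fv.
Qed.

Lemma pure_bot_to_Omega M : pure (bot_to_Omega M).
Proof.
  assert (HO : pure Omega).
  { intros Hy; unfold Omega in Hy;
      repeat match goal with H : bot_occurs _ |- _ => inversion H; clear H; subst end. }
  intros H; remember (bot_to_Omega M) as N eqn:E; revert M E.
  induction H; intros [] E; unfold_term; try discriminate;
    try (apply HO; rewrite <- E; eauto using bot_occurs; fail); inversion E; subst; eauto.
Qed.

Lemma pure_rename r M : pure M -> pure (rename r M).
Proof.
  intros H Hb; apply H; clear H; remember (rename r M) as N eqn:E; revert r M E.
  induction Hb; intros r [] E; unfold_term; inversion E; subst;
    eauto using bot_occurs.
Qed.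

Lemma pure_subst s M : (forall x, pure (s x)) -> pure M -> pure (subst s M).
Proof.
  intros Hs H Hb; apply H; clear H; remember (subst s M) as N eqn:E; revert s Hs M E.
  induction Hb; intros s Hs [] E; unfold_term; try discriminate;
    try (edestruct Hs; rewrite <- E; eauto using bot_occurs; fail);
    inversion E; subst; eauto using bot_occurs.
  constructor; apply (IHHb (up_subst s)); auto.
  intros [|x]; simpl; [intros Hx; inversion Hx|apply pure_rename, Hs].
Qed.

(** Applying the closure to the values of [s] at the abstracted indices undoes the abstractions. *)
Lemma ev_lams x k n M s Ns :
  closed (lams n M) -> ev x k (subst s M) Ns ->
  exists k' Ks, ev x k' (lams n M) (Ks ++ Ns) /\ forall K, In K Ks -> exists y, K = s y.
Proof.
  revert x k M s Ns; induction n as [|n IH]; intros x k M s Ns Hc H.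
  - exists k, []; split; [|intros ? []].
    eapply ev_bisim; [exact H|apply subst_closed, Hc].
  - assert (E : lams (S n) M = lams n (Lam M)) by apply Nat.iter_succ_r.
    rewrite E in Hc |- *.
    destruct (IH x (S k) (Lam M) (fun y => s (S y)) (s 0 :: Ns) Hc) as (k' & Ks & Hk & HK).
    + unfold_term; constructor; eapply ev_bisim; [exact H|].
      apply bisim_sym; eapply bisim_trans; [apply inst_subst_up|].
      apply subst_bisim; [intros [|y]|]; apply bisim_refl.
    + exists k', (Ks ++ [s 0]); rewrite <- app_assoc; split; [exact Hk|].
      intros K HKin; apply in_app_or in HKin as [HKin|[<-|[]]]; [|eauto].
      destruct (HK K HKin) as [y ->]; eauto.
Qed.

(* Closing a successful evaluation of an instance of [M] with I for all
   variables (and Omega for Bot) gives a reduction to I. *)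
Lemma bot_rule_inert M N : bot_rule M N -> inert M.
Proof.
  intros H s x k Ns Hev; destruct H as [M _ (_ & (M' & n & -> & Hc & Hmin) & Hn)].
  apply Hn; exists (lams n (bot_to_Omega M)); split; [exists n; auto|].
  (* [Bot] becomes [Omega] in the term, the substitution and the stack, because solvability admits
     only pure arguments. *)
  destruct (@ev_par_inv x k (subst (fun y => bot_to_Omega (s y)) (bot_to_Omega M))
              (subst s M) (map bot_to_Omega Ns) Ns Hev) as [k' Hk'].
  { apply par_subst; intros; apply par_bot_to_Omega. }
  { clear; induction Ns; constructor; auto using par_bot_to_Omega. }
  destruct (ev_lams Hc Hk') as (k'' & Ks & Hk'' & HK).
  pose proof (ev_steps (fun _ => tI) Hk'') as Hst; cbv beta in Hst.
  exists (map (subst (fun _ => tI)) (Ks ++ map bot_to_Omega Ns)); split.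
  - apply Forall_map, Forall_forall; intros K HKin.
    apply pure_subst.
    + intros _ Hb; unfold tI in Hb;
        repeat match goal with H : bot_occurs _ |- _ => inversion H; clear H; subst end.
    + apply in_app_or in HKin as [HKin|HKin].
      * destruct (HK K HKin) as [y ->]; apply pure_bot_to_Omega.
      * apply in_map_iff in HKin as (y & <- & _); apply pure_bot_to_Omega.
  - apply steps_red; eapply steps_trans; [|exact Hst].
    apply steps_apps, steps_bisim, bisim_sym, subst_closed, Hc.
Qed.

Lemma step_beta_bot_par d M N n : step beta_bot d M N -> par n M N.
Proof.
  intros (A & B & HA & H & HB).
  eapply par_bisim; [|apply bisim_sym, HA|exact HB]; clear HA HB.
  revert n; induction H as [A B [H|H]| | |]; intros [|m]; try constructor;
    auto using par_refl.
  - destruct H; constructor; apply par_refl.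
  - pose proof (bot_rule_inert H); destruct H; constructor; assumption.
Qed.

(** At a limit, an earlier term agreeing up to depth [k] carries the evaluation over, its bound
    still being [k]. *)
Lemma ev_red x k M N Ns : red beta_bot M N -> ev x k M Ns -> ev x k N Ns.
Proof.
  apply red_invariant with (P := fun M => ev x k M Ns); clear.
  - intros d M N H HM; eapply ev_par; [exact HM|apply (step_beta_bot_par _ H)|].
    apply Forall2_diag, par_refl.
  - intros M H; destruct (H k) as (N & HN & Hev).
    eapply ev_agree; [exact Hev|exact HN|apply Forall2_diag, agree_refl].
Qed.

(** Since the bound may grow backwards, the absence of evaluations is propagated forwards instead:
    an evaluation of a limit in [k'] transitions is already one of an earlier term agreeing up to
    depth [k']. *)
Lemma ev_red_inv x k M N Ns : red beta_bot M N -> ev x k N Ns -> exists k', ev x k' M Ns.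
Proof.
  intros H HN; apply NNPP; intros HM.
  enough (~ exists k, ev x k N Ns) as Hn by (apply Hn; eauto).
  clear HN; revert M N H HM.
  apply (@red_invariant _ (fun M => ~ exists k, ev x k M Ns)).
  - intros d M N H HM [k' Hk']; apply HM.
    eapply ev_par_inv; [exact Hk'|apply (step_beta_bot_par _ H)|].
    apply Forall2_diag, par_refl.
  - intros M H [k' Hk']; destruct (H k') as (N & HN & Hev); apply Hev; exists k'.
    eapply ev_agree; [exact Hk'|apply agree_sym, HN|apply Forall2_diag, agree_refl].
Qed.

(** * Solvability and evaluation *)

Lemma red_beta_beta_bot M N : red beta M N -> red beta_bot M N.
Proof. apply red_mono; intros A B H; left; exact H. Qed.

Lemma closed_solvable_ev M : closed_solvable M -> exists k Ns, ev 0 k M Ns.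
Proof.
  intros (Ns & _ & H).
  (* On the stack [Var 0], [tI] reaches that variable in two transitions. *)
  destruct (@ev_red_inv 0 2 (apps M Ns) tI [Var 0]) as [k Hk].
  - apply red_beta_beta_bot, H.
  - constructor; unfold inst; unfold_term; constructor.
  - exists k, (Ns ++ [Var 0]); apply ev_apps, Hk.
Qed.

Lemma unsolvable_bot_to_Omega M :
  closed M -> (forall k Ns, ~ ev 0 k M Ns) -> unsolvable (bot_to_Omega M).
Proof.
  intros Hc Hn; apply closed_bot_to_Omega in Hc as HcO.
  split; [apply pure_bot_to_Omega|split].
  - exists (bot_to_Omega M), 0; repeat split; auto; lia.
  - intros (M' & (n & -> & _ & Hmin) & Hs).
    (* The term is closed, so by minimality its closure adds no abstraction. *)
    destruct n as [|n]; [|exact (Hmin 0 (Nat.lt_0_succ n) HcO)].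
    destruct (closed_solvable_ev Hs) as (k & Ns & Hk).
    apply (Hn k Ns); eapply ev_par; [exact Hk|apply par_bot_to_Omega|].
    apply Forall2_diag, par_refl.
Qed.

(** * Normal forms *)

(** In an evaluating application the function part would be an abstraction, giving a redex, or a
    variable, which is stuck on a nonempty stack. Substituting variables changes neither. *)
Lemma normal_subst_ev x k M s Ns :
  normal beta_bot M -> ev x k (subst s M) Ns -> (forall y, exists z, s y = Var z) ->
  (exists P, M = Lam P) \/ exists y, M = Var y /\ Ns = [].
Proof.
  intros HM H Hs; revert M Ns HM H.
  induction k as [|k IH]; intros M Ns HM H; [inversion H|].
  destruct M as [y|P|P Q|]; unfold_term.
  - destruct (Hs y) as [z Hz]; rewrite Hz in H; inversion H; subst; eauto.
  - eauto.
  - inversion H as [|? ? ? ? H1|]; subst.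
    destruct (IH P) with (2 := H1) as [[P' ->]|(y & -> & Hnil)]; [| |discriminate].
    + intros (n & N & HN); apply HM; exists (S n), (App N Q).
      destruct HN as (A & B & HA & HAB & HB); exists (App A Q), (App B Q).
      repeat split; constructor; auto using bisim_refl.
    + destruct HM; exists 0, (inst P' Q), (App (Lam P') Q), (inst P' Q).
      repeat split; auto using bisim_refl. constructor; left; constructor.
  - inversion H.
Qed.

Lemma normal_Lam P : normal beta_bot (Lam P) -> normal beta_bot P.
Proof.
  intros H (n & N & A & B & HA & HAB & HB); apply H.
  exists (S n), (Lam N), (Lam A), (Lam B); repeat split; constructor; assumption.
Qed.

(** Consuming two arguments takes two abstractions. Indices count from the innermost binder, so
    selecting argument [c] means the body [Var (1 - c)]: [tT] for 0 and [tF] for 1. *)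
Lemma normal_ev_bool c k B :
  closed B -> normal beta_bot B -> c < 2 -> ev c k B [Var 0; Var 1] ->
  B = Lam (Lam (Var (1 - c))).
Proof.
  intros Hc HB Hc2 H.
  apply ev_bisim with (2 := bisim_sym (subst_Var_id B)) in H as H0.
  destruct (normal_subst_ev HB H0) as [[P ->]|(y & _ & Hy)]; [eauto| |discriminate].
  apply normal_Lam in HB; inversion H as [| |k1 ? ? ? H1]; subst.
  destruct (normal_subst_ev HB H1) as [[P' ->]|(y & _ & Hy)];
    [intros []; eauto| |discriminate].
  apply normal_Lam in HB; unfold inst in H1; unfold_term.
  inversion H1 as [| |k2 ? ? ? H2]; subst.
  apply ev_bisim with (2 := inst_subst_up _ _ _) in H2.
  destruct (normal_subst_ev HB H2) as [[P ->]|(y & -> & _)];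
    [intros [|[|]]; simpl; eauto| |].
  (* A third abstraction would meet the empty stack. *)
  { unfold_term; inversion H2. }
  unfold_term; destruct y as [|[|y]]; simpl in H2; inversion H2; subst; try reflexivity.
  (* An index from 2 on would be free in the closed term [B]. *)
  destruct (Hc y); repeat constructor.
Qed.

Lemma normal_Var x : normal beta_bot (Var x).
Proof.
  intros (n & N & A & B & HA & HAB & _); inversion HA; subst.
  inversion HAB as [? ? [H|H]| | |]; subst; [inversion H|].
  apply (@ev_inert x 1 (Var x) []); [constructor|apply (bot_rule_inert H)].
Qed.

(** A term that evaluates is not inert, so the bot rule cannot apply at its root. *)
Lemma normal_Lam_ev x k P Ns :
  normal beta_bot P -> ev x k (Lam P) Ns -> normal beta_bot (Lam P).
Proof.
  intros HP Hev (n & N & A & B & HA & HAB & _).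
  apply ev_inert in Hev; inversion HA as [|? P' HP'| |]; subst.
  inversion HAB as [? ? [H|H]|n' ? P'' H| |]; subst; [inversion H| |].
  - apply Hev, (inert_bisim (bot_rule_inert H)), bisim_sym, HA.
  - apply HP; exists n', P'', P', P''; auto using bisim_refl.
Qed.

Lemma ev_bool c : c < 2 -> ev c 3 (Lam (Lam (Var (1 - c)))) [Var 0; Var 1].
Proof.
  destruct c as [|[|c]]; [| |lia]; intros _; simpl;
    repeat (constructor || (unfold inst; unfold_term; simpl; unfold_term)).
Qed.

Lemma normal_bool c : c < 2 -> normal beta_bot (Lam (Lam (Var (1 - c)))).
Proof.
  intros Hc; pose proof (ev_bool Hc) as H.
  apply (normal_Lam_ev (Ns := [Var 0; Var 1]) (x := c) (k := 3)); [|exact H].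
  (* With argument [Var 0], both possible bodies [Var 0] and [Var 1] turn into [Var 0]. *)
  apply (normal_Lam_ev (Ns := [Var 0]) (x := 0) (k := 2)); [apply normal_Var|].
  destruct c as [|[|c]]; [| |lia];
    repeat (constructor || (unfold inst; unfold_term; simpl; unfold_term)).
Qed.

Lemma normal_Bot : normal beta_bot Bot.
Proof.
  intros (n & N & A & B & HA & HAB & _); inversion HA; subst.
  inversion HAB as [? ? [H|H]| | |]; subst; inversion H; congruence.
Qed.

(** The evaluation travels back from the boolean to [M] and forward to any other normal form, which
    must then be the same boolean. *)
Lemma bohm_tree_bool c M :
  c < 2 -> closed M -> red beta_bot M (Lam (Lam (Var (1 - c)))) ->
  bohm_tree M (Lam (Lam (Var (1 - c)))).
Proof.
  intros Hc HM H; split; [exact H|split; [apply normal_bool, Hc|]].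
  intros B HB HnB; destruct (ev_red_inv H (ev_bool Hc)) as [k Hk].
  apply (ev_red HB) in Hk; rewrite (normal_ev_bool (closed_red_beta_bot HB HM) HnB Hc Hk).
  apply bisim_refl.
Qed.

(** No reduct of [M] evaluates to [Var 0] either, so each reduct other than [Bot] is itself a redex
    of the bot rule. *)
Lemma bohm_tree_Bot M :
  closed M -> (forall k Ns, ~ ev 0 k M Ns) -> bohm_tree M Bot.
Proof.
  intros HM Hn.
  assert (Hs : forall N, closed N ->
    (forall k Ns, ~ ev 0 k N Ns) -> N = Bot \/ step beta_bot 0 N Bot).
  { intros N HN Hev; destruct (classic (N = Bot)) as [|Hne]; [auto|right].
    exists N, Bot; repeat split; auto using bisim_refl.
    constructor; right; constructor; auto using unsolvable_bot_to_Omega. }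
  split; [|split; [apply normal_Bot|]].
  - apply steps_red; destruct (Hs M) as [->|H]; auto.
    + apply steps_bisim, bisim_refl.
    + eapply steps_cons; [exact H|apply steps_bisim, bisim_refl].
  - intros B HB HnB; destruct (Hs B) as [->|H]; auto using bisim_refl.
    + exact (closed_red_beta_bot HB HM).
    + intros k Ns Hev; destruct (ev_red_inv HB Hev) as [k' Hk']; exact (Hn _ _ Hk').
    + destruct HnB; eauto.
Qed.

(** * Propositions *)

(** The constants are written as encodings, so that every compound proposition applies one encoded
    proposition to two others. *)
Lemma term_eta_encode a : encode a =
  match a with
  | PVar p => Var p
  | PTrue => tT
  | PFalse => tF
  | PAnd a b => App (App (encode a) (encode b)) (encode a)
  | POr a b => App (App (encode a) (encode a)) (encode b)
  | PImp a b => App (App (encode a) (encode b)) (encode PTrue)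
  | PNot a => App (App (encode a) (encode PFalse)) (encode PTrue)
  end.
Proof.
  rewrite (term_eta (encode PTrue)), (term_eta (encode PFalse)), (term_eta (encode a)).
  destruct a; reflexivity.
Qed.

Lemma encode_inv a : closed_formula a ->
  encode a = tT \/ encode a = tF \/
  exists b c d, encode a = App (App (encode b) (encode c)) (encode d) /\
    closed_formula b /\ closed_formula c /\ closed_formula d.
Proof.
  intros H.
  assert (HT : closed_formula PTrue) by (intros p Hp; inversion Hp).
  assert (HF : closed_formula PFalse) by (intros p Hp; inversion Hp).
  rewrite (term_eta_encode a).
  destruct a; [destruct (H p); constructor|auto..| | | |]; right; right;
    do 3 eexists; split; try reflexivity; repeat split; auto;
    intros q Hq; apply (H q); constructor; assumption.
Qed.

Lemma closed_encode a : closed_formula a -> closed (encode a).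
Proof.
  intros Ha x Hx.
  (* The path to an occurrence also passes through partial applications of two encodings, hence the
     second conjunct. *)
  enough (Hn : forall y M, fv y M ->
    (forall a, closed_formula a -> M <> encode a) /\
    (forall a b, closed_formula a -> closed_formula b -> M <> App (encode a) (encode b)))
    by exact (proj1 (Hn x (encode a) Hx) a Ha eq_refl).
  clear; induction 1 as [x|x M HM _|x M N _ [IH1 IH2]|x M N _ [IH1 IH2]];
    (split; [intros a Ha E|intros a b Ha Hb E; try discriminate]);
    try (destruct (encode_inv Ha) as [E'|[E'|(b & c & d & E' & Hb & Hc & Hd)]];
      rewrite E' in E; try discriminate);
    injection E as E1; subst.
  - inversion HM as [|? ? H1| |]; inversion H1.
  - inversion HM as [|? ? H1| |]; inversion H1.
  - exact (IH2 _ _ Hb Hc eq_refl).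
  - exact (IH1 _ Ha eq_refl).
  - exact (IH1 _ Hd eq_refl).
  - exact (IH1 _ Hb eq_refl).
Qed.

Lemma steps_tT P Q : steps beta (App (App tT P) Q) P.
Proof.
  eapply steps_trans; [eapply (steps_apps [Q]), steps_beta|].
  unfold inst; unfold_term; simpl.
  eapply steps_trans; [apply steps_beta|apply steps_bisim, inst_rename_S].
Qed.

Lemma steps_tF P Q : steps beta (App (App tF P) Q) Q.
Proof.
  eapply steps_trans; [eapply (steps_apps [Q]), steps_beta|].
  unfold inst; unfold_term; simpl.
  eapply steps_trans; [apply steps_beta|apply steps_bisim].
  unfold inst; unfold_term; apply bisim_refl.
Qed.

Lemma ev_tT x k P Q Ns : ev x k tT (P :: Q :: Ns) -> ev x k P Ns.
Proof.
  intros H; inversion H as [| |k1 ? ? ? H1]; subst; unfold inst in H1; unfold_term.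
  inversion H1; subst; simpl in *.
  eapply ev_bisim; [|apply inst_rename_S]; eapply ev_le; [eassumption|lia].
Qed.

Lemma ev_tF x k P Q Ns : ev x k tF (P :: Q :: Ns) -> ev x k Q Ns.
Proof.
  intros H; inversion H as [| |k1 ? ? ? H1]; subst; unfold inst in H1; unfold_term.
  inversion H1 as [| |k2 ? ? ? H2]; subst; unfold inst in H2; unfold_term.
  eapply ev_le; [eassumption|lia].
Qed.

Lemma ev_encode a x k Ns : closed_formula a -> ev x k (encode a) Ns ->
  steps beta (encode a) tT \/ steps beta (encode a) tF.
Proof.
  revert a Ns; induction k as [k IH] using lt_wf_ind; intros a Ns Ha H.
  (* The head [b] evaluates with two transitions fewer, so by induction it is a boolean and selects
     [P] or [Q]. *)
  assert (HC : forall b P Q, closed_formula b -> ev x k (App (App (encode b) P) Q) Ns ->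
    exists j, j < k /\
     ((steps beta (encode b) tT /\ steps beta (App (App (encode b) P) Q) P /\ ev x j P Ns) \/
      (steps beta (encode b) tF /\ steps beta (App (App (encode b) P) Q) Q /\ ev x j Q Ns))).
  { clear a Ha H; intros b P Q Hb H.
    inversion H as [|k1 ? ? ? H1|]; subst; inversion H1 as [|k2 ? ? ? H2|]; subst.
    exists k2; split; [lia|].
    destruct (IH k2) with (3 := H2) as [HS|HS]; [lia|assumption|left|right];
      (split; [exact HS|split]);
      try (eapply steps_trans; [eapply (steps_apps [P; Q]), HS|]);
      try apply steps_tT; try apply steps_tF;
      apply (ev_red (red_beta_beta_bot (steps_red HS))) in H2.
    - exact (ev_tT H2).
    - exact (ev_tF H2). }
  (* The selected argument is again a closed proposition, evaluating within a smaller bound. *)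
  assert (HV : forall b M j, closed_formula b -> steps beta M (encode b) ->
     j < k -> ev x j (encode b) Ns -> steps beta M tT \/ steps beta M tF).
  { intros b M j Hb HM Hj Hev.
    destruct (IH j Hj b Ns Hb Hev) as [HS|HS]; [left|right];
      exact (steps_trans HM HS). }
  rewrite (term_eta_encode a) in H |- *.
  destruct a as [p| | |a b|a b|a b|a]; [destruct (Ha p); constructor| | |..].
  { left; apply steps_bisim, bisim_refl. }
  { right; apply steps_bisim, bisim_refl. }
  all: assert (closed_formula PTrue) by (intros p Hp; inversion Hp).
  all: assert (closed_formula PFalse) by (intros p Hp; inversion Hp).
  all: assert (closed_formula a) by (intros p Hp; apply (Ha p); constructor; exact Hp).
  1-3: assert (closed_formula b) by (intros p Hp; apply (Ha p); constructor; exact Hp).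
  all: apply HC in H as (j & Hj & [(_ & HS & Hev)|(_ & HS & Hev)]); eauto.
Qed.

Theorem theorem3 (phi : formula) (Hphi : closed_formula phi) :
  bohm_tree (encode phi) tT \/
  bohm_tree (encode phi) tF \/
  bohm_tree (encode phi) Bot.
Proof.
  pose proof (closed_encode Hphi) as Hc.
  destruct (classic (exists k Ns, ev 0 k (encode phi) Ns)) as [(k & Ns & H)|Hn].
  - destruct (ev_encode Hphi H) as [HS|HS]; apply steps_red, red_beta_beta_bot in HS.
    + left; apply (@bohm_tree_bool 0); auto.
    + right; left; apply (@bohm_tree_bool 1); auto.
  - right; right; apply bohm_tree_Bot; [exact Hc|]; eauto.
Qed.
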